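(* For any two independent real-valued continuous random variables $X,Y$, $$h(X+Y)\leq 3h(X-Y)-h(X)-h(Y).$$ Equivalently, for any pair of real-valued continuous random variables $X,Y$, $d_R(X,-Y)\leq 3\,d_R(X,Y)$.
   Context: Standing conventions: random variables are real-valued with densities and all differential entropies $h$ appearing exist and are finite. The Ruzsa distance is $d_R(X,Y)=h(X'-Y')-\tfrac12h(X')-\tfrac12h(Y')$ with $X'\sim X$, $Y'\sim Y$ independent. *)

(* Defs.v *)
From HB Require Import structures.
From mathcomp Require Import all_boot all_order all_algebra.
From mathcomp Require Import all_classical all_reals all_analysis.
Set Implicit Arguments. Unset Strict Implicit. Unset Printing Implicit Defensive.
Import Order.TTheory GRing.Theory Num.Theory.
Local Open Scope classical_set_scope.
Local Open Scope ring_scope.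

Definition indep2 (R : realType) d (T : measurableType d)
  (P : probability T R) (X Y : T -> R) : Prop :=
  forall A B : set R, measurable A -> measurable B ->
    P (X @^-1` A `&` Y @^-1` B) = (P (X @^-1` A) * P (Y @^-1` B))%E.

Definition is_density (R : realType) d (T : measurableType d)
  (P : probability T R) (X : T -> R) (f : R -> R) : Prop :=
  [/\ measurable_fun setT f, (forall x, 0 <= f x) &
      forall A : set R, measurable A ->
        P (X @^-1` A) = (\int[@lebesgue_measure R]_(x in A) (f x)%:E)%E].

Definition finite_entropy (R : realType) (f : R -> R) : Prop :=
  (@lebesgue_measure R).-integrable setT (fun x => (f x * ln (f x))%:E).

Definition diff_entropy (R : realType) (f : R -> R) : R :=
  - Rintegral (@lebesgue_measure R) setT (fun x => f x * ln (f x)).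

(* Main.v *)
(** Let [F], [G], [S], [D] be the densities of [X], [Y], [X + Y], [X - Y].  Take
    two copies [(x1, y1)], [(x2, y2)] of [(X, Y)] that are conditionally
    independent given a common difference [z = x1 - y1 = x2 - y2], and a third
    copy [(x3, y3)] independent of both.  Then [x1 - y3] and [x3 - y2] have
    density [D], and the nonnegative function
    [r = D (x3 - y2) D (x1 - y3) D z / (F x1 G y2 S (x3 + y3))]
    has expectation at most [1]: multiplied by the joint density it becomes
    [D a D b F x2 G y1 F x3 G y3 / S (x3 + y3)] with [a = x3 - y2] and
    [b = x1 - y3], where [x3 + y3 = a - b + x2 + y1], so that integrating out
    [x3] cancels [S].  Hence [E (ln r) <= E r - 1 <= 0], and
    [E (ln r) = - 3 h(X - Y) + h(X) + h(Y) + h(X + Y)]. *)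

Require Import Defs.
From HB Require Import structures.
From mathcomp Require Import all_boot all_order all_algebra.
From mathcomp Require Import all_classical all_reals all_analysis.
From mathcomp Require Import measurable_realfun ring lra.
Set Implicit Arguments.
Unset Strict Implicit.
Unset Printing Implicit Defensive.
Import Order.TTheory GRing.Theory Num.Theory.
Local Open Scope classical_set_scope.
Local Open Scope ring_scope.

(** * Measures given by a density *)

Section density_measure.
Local Open Scope ereal_scope.
Context d (T : measurableType d) (R : realType).
Variables (m : {measure set T -> \bar R}) (w : T -> R).
Hypotheses (mw : measurable_fun setT w) (w0 : forall x, (0 <= w x)%R).
Hypothesis w1 : \int[m]_x (w x)%:E = 1.

(** The three proofs are arguments of the definition, so that the measure and probability structures
    attached to it can be inferred from the term alone. *)
Definition density_prob of measurable_fun setT w & (forall x, (0 <= w x)%R)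
    & \int[m]_x (w x)%:E = 1 : set T -> \bar R :=
  fun A => \int[m]_(x in A) (w x)%:E.

Local Notation dprob := (density_prob mw w0 w1).

Let dprob0 : dprob set0 = 0.
Proof. exact: integral_set0. Qed.

Let dprob_ge0 A : 0 <= dprob A.
Proof. by apply: integral_ge0 => x _; rewrite lee_fin. Qed.

Let dprob_sigma_additive : semi_sigma_additive dprob.
Proof.
move=> /= F mF tF mUF; rewrite /density_prob; apply: cvg_toP.
  apply: ereal_nondecreasing_is_cvgn => a b ab.
  apply: lee_sum_nneg_natr => // k _ _.
  by apply: integral_ge0 => x _; rewrite lee_fin.
rewrite ge0_integral_bigcup//=.
- by apply/measurable_EFinP; exact: measurable_funTS.
- by move=> x _; rewrite lee_fin.
Qed.

HB.instance Definition _ :=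
  isMeasure.Build _ _ _ dprob dprob0 dprob_ge0 dprob_sigma_additive.

HB.instance Definition _ := @Measure_isProbability.Build _ _ R dprob w1.

End density_measure.

Section integral_density.
Local Open Scope ereal_scope.
Context d (T : measurableType d) (R : realType).
Variables (n m : {measure set T -> \bar R}) (w : T -> R).
Hypotheses (mw : measurable_fun setT w) (w0 : forall x, (0 <= w x)%R).
Hypothesis nE : forall A, measurable A -> n A = \int[m]_(x in A) (w x)%:E.

Import HBNNSimple.

Let integral_density_nnsfun (h : {nnsfun T >-> R}) :
  \int[n]_x (h x)%:E = \int[m]_x ((w x)%:E * (h x)%:E).
Proof.
under [LHS]eq_integral do rewrite fimfunE -fsumEFin//.
rewrite [LHS]ge0_integral_fsum//; last 2 first.
  - by move=> r; exact/measurable_EFinP/measurableT_comp.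
  - by move=> r x _; rewrite EFinM nnfun_muleindic_ge0.
under [RHS]eq_integral.
  move=> x _; rewrite fimfunE -fsumEFin// ge0_mule_fsumr; last first.
    by move=> r; rewrite EFinM nnfun_muleindic_ge0.
  over.
rewrite [RHS]ge0_integral_fsum//; last 2 first.
  - move=> r; apply: emeasurable_funM; first exact/measurable_EFinP.
    exact/measurable_EFinP/measurableT_comp.
  - by move=> r x _; rewrite mule_ge0 ?lee_fin// -lee_fin EFinM nnfun_muleindic_ge0.
apply: eq_fsbigr => r rh.
have r0 : (0 <= r)%R by move: rh; rewrite inE => -[x _ <-].
have mr : measurable (h @^-1` [set r]) by [].
under eq_integral do rewrite EFinM.
under [RHS]eq_integral do rewrite EFinM muleCA.
rewrite ge0_integralZl//; last first.
  - exact/measurable_EFinP.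
rewrite ge0_integralZl//; last 2 first.
  - by apply: emeasurable_funM; exact/measurable_EFinP.
  - by move=> x _; rewrite mule_ge0 ?lee_fin.
congr (_ * _); rewrite integral_indic// setIT nE//.
by rewrite integral_mkcond; apply: eq_integral => x _; rewrite epatch_indic.
Qed.

(** The case of simple functions passes to the limit on both sides by monotone convergence along
    [nnsfun_approx]. *)
Lemma integral_density (h : T -> \bar R) :
  measurable_fun setT h -> (forall x, 0 <= h x) ->
  \int[n]_x h x = \int[m]_x ((w x)%:E * h x).
Proof.
move=> mh h0; pose h_ := nnsfun_approx measurableT mh.
have cvgh x : (EFin \o h_^~ x) k @[k --> \oo] --> h x.
  exact: cvg_nnsfun_approx.
transitivity (limn (fun k => \int[n]_x (h_ k x)%:E)).
  rewrite -monotone_convergence//=.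
  - by apply: eq_integral => x _; apply/esym/cvg_lim => //; exact: cvgh.
  - by move=> k; exact/measurable_EFinP.
  - by move=> k x _; rewrite lee_fin.
  - by move=> x _ a b ab; rewrite lee_fin; exact/lefP/nd_nnsfun_approx.
under eq_fun do rewrite integral_density_nnsfun.
rewrite -monotone_convergence//=.
- apply: eq_integral => x _; apply/cvg_lim => //.
  by apply: cvgeZl => //; exact: cvgh.
- by move=> k; apply: emeasurable_funM; exact/measurable_EFinP.
- by move=> k x _; rewrite mule_ge0 ?lee_fin.
- move=> x _ a b ab; rewrite lee_wpmul2l ?lee_fin//.
  exact/lefP/nd_nnsfun_approx.
Qed.

End integral_density.

(** * Translation and reflection invariance of Lebesgue integrals *)

Section lebesgue_invariance.
Local Open Scope ereal_scope.
Context {R : realType}.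
Local Notation lambda := (@lebesgue_measure R).

Lemma lebesgue_integral_shift (c : R) (h : R -> \bar R) :
  measurable_fun setT h -> (forall x, 0 <= h x) ->
  \int[lambda]_x h (x + c)%R = \int[lambda]_x h x.
Proof.
move=> mh h0.
pose shift (x : measurableTypeR R) : measurableTypeR R := (x + c)%R.
have mc : measurable_fun setT shift by exact: measurable_funD.
transitivity (\int[pushforward lambda shift]_x h x).
  by rewrite ge0_integral_pushforward.
apply: eq_measure_integral => /= A mA _; apply/esym.
(* The image of Lebesgue measure under translation only has to be compared with it on half-open
   intervals. *)
apply: lebesgue_measure_unique => //= _ [[a b]] _ <-.
rewrite /pushforward.
rewrite (_ : _ @^-1` _ = `]a - c, b - c]%classic)%R; last first.
  by apply/seteqP; split => x /=; rewrite !in_itv/= ltrBlDr lerBrDr.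
rewrite !lebesgue_measure_itv/= !lte_fin ltrD2r.
by case: ifP => // _; rewrite -!EFinB; congr EFin; rewrite opprB addrA subrK.
Qed.

Lemma lebesgue_integral_opp (h : R -> \bar R) :
  measurable_fun setT h -> (forall x, 0 <= h x) ->
  \int[lambda]_x h (- x)%R = \int[lambda]_x h x.
Proof.
move=> mh h0.
transitivity (\int[pushforward lambda (-%R : _ -> measurableTypeR R)]_x h x).
  by rewrite ge0_integral_pushforward.
by apply: eq_measure_integral => A mA _; exact: lebesgue_measureN.
Qed.

End lebesgue_invariance.

(** * Measurability tools *)

Lemma measurable_invr (R : realType) : measurable_fun setT (@GRing.inv R).
Proof.
(* Since [x ^+ 2] is nonnegative, its real power of exponent [-1] is its inverse; at [0] both sides
   are [0]. *)
rewrite (_ : @GRing.inv R = fun x => x * (x ^+ 2) `^ (-1)); last first.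
  apply/funext => x; rewrite powR_inv1 ?sqr_ge0//.
  have [->|x0] := eqVneq x 0; first by rewrite invr0 mul0r.
  by rewrite expr2 invfM mulrA divff// mul1r.
apply: measurable_funM => //.
apply: (measurableT_comp (@measurable_powR R (-1))).
exact: measurable_funX.
Qed.

Ltac mfun := repeat first
  [ match goal with
    | H : measurable_fun _ ?f |- measurable_fun _ ?f => exact: H
    | H : measurable_fun _ ?f |- measurable_fun _ (fun x => ?f x) => exact: H
    end
  | lazymatch goal with
    | |- measurable_fun _ (fun x => x) => exact: measurable_id
    | |- measurable_fun _ (fun x => (@?a x * @?b x)%E) => apply: emeasurable_funM
    | |- measurable_fun _ (fun x => (@?a x)%:E) => apply/measurable_EFinP
    | |- measurable_fun _ (fun x => (@?a x - @?b x)%R) => apply: measurable_funB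
    | |- measurable_fun _ (fun x => (@?a x + @?b x)%R) => apply: measurable_funD
    | |- measurable_fun _ (fun x => (- @?a x)%R) => apply: measurable_funN
    | |- measurable_fun _ (fun x => (@?a x * @?b x)%R) => apply: measurable_funM
    | |- measurable_fun _ (fun x => (@?a x)^-1%R) =>
        apply: (measurableT_comp (@measurable_invr _))
    | |- measurable_fun _ (fun x => ln (@?a x)) =>
        apply: (measurableT_comp (@measurable_ln _))
    | |- measurable_fun _ (fun x => expR (@?a x)) =>
        apply: (measurableT_comp (@measurable_expR _))
    | |- measurable_fun _ (fun x => (@?a x).1) => apply: (measurableT_comp measurable_fst)
    | |- measurable_fun _ (fun x => (@?a x).2) => apply: (measurableT_comp measurable_snd)
    | |- measurable_fun _ (fun x => (@?a x, @?b x)) => apply/measurable_fun_pair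
    | |- measurable_fun _ (fun x => ?f (@?g x)) => apply: (@measurableT_comp _ _ _ _ _ _ f _ g)
    | |- measurable_fun _ (EFin \o _) => apply/measurable_EFinP
    | |- measurable_fun _ (_ \o _) => apply: measurableT_comp
    | |- measurable_fun _ fst => exact: measurable_fst
    | |- measurable_fun _ snd => exact: measurable_snd
    | |- measurable_fun _ id => exact: measurable_id
    end
  | exact: measurable_cst ].

Lemma integral_cst_prob d (T : measurableType d) (R : realType)
  (P : probability T R) (c : \bar R) : (\int[P]_x c = c)%E.
Proof. by rewrite integral_cst// [X in (_ * X)%E]probability_setT mule1. Qed.

(** * Laws with a density, and expectations of log-densities *)

Section law.
Local Open Scope ereal_scope.
Context d (U : measurableType d) (R : realType).
Local Notation lambda := (@lebesgue_measure R).

(** The density is tested on nonnegative functions instead of sets, so that computing a marginal law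
    amounts to rewriting integrals. *)
Definition has_law (m : {measure set U -> \bar R}) (Z : U -> R) (f : R -> R) :=
  forall h : R -> \bar R, measurable_fun setT h -> (forall x, 0 <= h x) ->
  \int[m]_u h (Z u) = \int[lambda]_x ((f x)%:E * h x).

Lemma is_density_has_law (P : probability U R) (Z : U -> R) (f : R -> R) :
  measurable_fun setT Z -> is_density P Z f -> has_law P Z f.
Proof.
move=> mZ [mf f0 Pf] h mh h0.
transitivity (\int[pushforward P (Z : U -> measurableTypeR R)]_x h x).
  by rewrite ge0_integral_pushforward.
exact: integral_density.
Qed.

Lemma has_law_total (P : probability U R) (Z : U -> R) (f : R -> R) :
  has_law P Z f -> \int[lambda]_x (f x)%:E = 1.
Proof.
move=> /(_ (cst 1) (@measurable_cst _ _ _ _ _ _)).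
rewrite integral_cst_prob => -> //.
by apply: eq_integral => x _; rewrite mule1.
Qed.

Variables (m : {measure set U -> \bar R}) (Z : U -> R) (f : R -> R).
Hypotheses (mZ : measurable_fun setT Z) (mf : measurable_fun setT f).
Hypotheses (f0 : forall x, (0 <= f x)%R) (lawZ : has_law m Z f).

(** The mass of the preimage of [B] is the integral of [f] over [B], which is zero. *)
Lemma has_law_ae (B : set R) : measurable B ->
  {ae lambda, forall x, B x -> f x = 0%R} -> {ae m, forall u, ~ B (Z u)}.
Proof.
move=> mB fB; exists (Z @^-1` B); split.
- by rewrite -[_ @^-1` _]setTI; exact: mZ.
- have mZB : measurable (Z @^-1` B) by rewrite -[_ @^-1` _]setTI; exact: mZ.
  rewrite -[X in m X]setIT -integral_indic//.
  have := @lawZ (fun x => (\1_B x)%:E) _ _; rewrite {1}/preimage => ->//; last first.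
    exact/measurable_EFinP/measurable_indic.
  rewrite -[RHS](integral0 lambda setT); apply: ae_eq_integral => //.
    by apply: emeasurable_funM; apply/measurable_EFinP.
  apply: (@filterS _ _ (ae_filter_ringOfSetsType lambda) _ _ _ fB) => x fx _ /=.
  rewrite indicE.
  by have [/set_mem/fx ->|] := boolP (x \in B); rewrite ?mul0e// mule0.
- by move=> u /=; rewrite notK.
Qed.

(** The zero set of [f] has no mass under the law of [Z]. Later this ensures that logarithms and
    inverses of densities are almost surely taken at positive values. *)
Lemma has_law_gt0 : {ae m, forall u, (0 < f (Z u))%R}.
Proof.
have mB : measurable (f @^-1` [set 0%R]).
  by rewrite -[_ @^-1` _]setTI; exact: mf.
apply: filterS (has_law_ae mB (aeW _ _)) => //= u fu.
by rewrite lt_neqAle f0 andbT eq_sym; apply/eqP.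
Qed.

(** The product [f x * (f x)^-1] is [1] where [f x] is positive and [0] where [f x = 0], because
    [0^-1 = 0]. The mass of [h] on the zero set of [f] is lost, hence an inequality. *)
Lemma has_law_invr_le (h : R -> \bar R) :
  measurable_fun setT h -> (forall x, 0 <= h x) ->
  \int[m]_u (((f (Z u))^-1)%:E * h (Z u)) <= \int[lambda]_x h x.
Proof.
move=> mh h0; rewrite (@lawZ (fun x => ((f x)^-1)%:E * h x)) => [||x]; last first.
- by rewrite mule_ge0// lee_fin invr_ge0.
- by mfun.
apply: ge0_le_integral => //.
- by move=> x _; rewrite !mule_ge0// lee_fin// invr_ge0.
- by mfun.
- move=> x _; rewrite muleA -EFinM; have [->|fx0] := eqVneq (f x) 0%R.
    by rewrite mul0r mul0e.
  by rewrite divff// mul1e.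
Qed.

(** [has_law] takes nonnegative test functions, so the positive and negative parts of [ln f] are
    transferred separately; as [f] is nonnegative, multiplying them by [f] gives the two parts of
    [f * ln f]. *)
Lemma has_law_integral_ln : finite_entropy f ->
  m.-integrable setT (fun u => (ln (f (Z u)))%:E) /\
  Rintegral m setT (fun u => ln (f (Z u))) = (- diff_entropy f)%R.
Proof.
move=> fe.
have posE : \int[m]_u (fun u => (ln (f (Z u)))%:E)^\+ u =
    \int[lambda]_x (fun x => (f x * ln (f x))%:E)^\+ x.
  transitivity (\int[lambda]_x ((f x)%:E * (fun x => (ln (f x))%:E)^\+ x)).
    rewrite -(@lawZ (fun x => (ln (f x))%:E)^\+)//.
      by apply: eq_integral => u _; rewrite !funeposE.
    by apply: measurable_funepos; mfun.
  apply: eq_integral => x _; rewrite !funeposE EFinM.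
  by rewrite maxe_pMr ?lee_fin// mule0.
have negE : \int[m]_u (fun u => (ln (f (Z u)))%:E)^\- u =
    \int[lambda]_x (fun x => (f x * ln (f x))%:E)^\- x.
  transitivity (\int[lambda]_x ((f x)%:E * (fun x => (ln (f x))%:E)^\- x)).
    rewrite -(@lawZ (fun x => (ln (f x))%:E)^\-)//.
      by apply: eq_integral => u _; rewrite !funenegE.
    by apply: measurable_funeneg; mfun.
  apply: eq_integral => x _; rewrite !funenegE EFinM.
  by rewrite -muleN maxe_pMr ?lee_fin// mule0.
split; last first.
  by rewrite /diff_entropy opprK /Rintegral integralE posE negE -integralE.
have mlnfZ : measurable_fun setT (fun u => (ln (f (Z u)))%:E) by mfun.
apply/integrableP; split=> //.
rewrite -[ltLHS]/(\int[m]_u (abse \o (fun u => (ln (f (Z u)))%:E)) u).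
rewrite fune_abse ge0_integralD//=; last 2 first.
- exact: measurable_funepos.
- exact: measurable_funeneg.
rewrite posE negE lte_add_pinfty//.
- exact: integral_funepos_lt_pinfty fe.
- exact: integral_funeneg_lt_pinfty fe.
Qed.

End law.

(* Gibbs' inequality, in the form [E phi <= E (e^phi) - 1 <= 0]. *)
Lemma Rintegral_le0_expR d (U : measurableType d) (R : realType)
    (P : probability U R) (phi : U -> R) :
  P.-integrable setT (EFin \o phi) ->
  (\int[P]_u (expR (phi u))%:E <= 1)%E -> Rintegral P setT phi <= 0.
Proof.
move=> iphi ephi1.
have mphi : measurable_fun setT phi.
  by apply/measurable_EFinP; exact: (measurable_int P).
have iexp : P.-integrable setT (EFin \o (expR \o phi)).
  apply/integrableP; split; first by mfun.
  under eq_integral do rewrite /= ger0_norm ?expR_ge0//.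
  exact: le_lt_trans ephi1 (ltry _).
have i1 : P.-integrable setT (EFin \o cst (1 : R)).
  exact: finite_measure_integrable_cst.
have : Rintegral P setT (fun u => 1 + phi u) <= Rintegral P setT (expR \o phi).
  apply: le_Rintegral => //; first exact: (integrableD measurableT i1 iphi).
  by move=> u _; exact: expR_ge1Dx.
rewrite RintegralD// (_ : Rintegral P setT (fun=> 1) = 1); last first.
  by rewrite Rintegral_cst// mul1r [X in fine X]probability_setT.
move=> /le_trans => /(_ 1); rewrite gerDl; apply.
rewrite -lee_fin /Rintegral fineK//.
exact: integrable_fin_num.
Qed.

(** * Marginals of product measures, plain and weighted *)

Section product_marginals.
Local Open Scope ereal_scope.
Context d1 d2 (T1 : measurableType d1) (T2 : measurableType d2) (R : realType).
Variables (m1 : probability T1 R) (m2 : probability T2 R).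

Lemma integral_prod_fst (k : T1 -> \bar R) :
  measurable_fun setT k -> (forall x, 0 <= k x) ->
  \int[m1 \x m2]_p k p.1 = \int[m1]_x k x.
Proof.
move=> mk k0; rewrite fubini_tonelli1//; last by mfun.
by apply: eq_integral => x _; rewrite /fubini_F/= integral_cst_prob.
Qed.

Lemma integral_prod_snd (k : T2 -> \bar R) :
  measurable_fun setT k -> (forall x, 0 <= k x) ->
  \int[m1 \x m2]_p k p.2 = \int[m2]_x k x.
Proof.
move=> mk k0; rewrite fubini_tonelli2//; last by mfun.
by apply: eq_integral => x _; rewrite /fubini_G/= integral_cst_prob.
Qed.

Variable w : T1 * T2 -> R.
Hypotheses (mw : measurable_fun setT w) (w0 : forall p, (0 <= w p)%R).

(** By Tonelli, the inner integral of the weight is [1] almost everywhere, so the weight does not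
    change the first marginal. *)
Lemma integral_weighted_fst (k : T1 -> \bar R) :
  {ae m1, forall x, \int[m2]_y (w (x, y))%:E = 1} ->
  measurable_fun setT k -> (forall x, 0 <= k x) ->
  \int[m1 \x m2]_p ((w p)%:E * k p.1) = \int[m1]_x k x.
Proof.
move=> w1 mk k0.
have mwk : measurable_fun setT (fun p => (w p)%:E * k p.1) by mfun.
have wk0 p : 0 <= (w p)%:E * k p.1 by rewrite mule_ge0// lee_fin.
rewrite fubini_tonelli1//; apply: ae_eq_integral => //.
  exact: measurable_fun_fubini_tonelli_F.
apply: filterS w1 => x wx _; rewrite /fubini_F/= ge0_integralZr//.
- by rewrite wx mul1e.
- by mfun.
- by move=> y _; rewrite lee_fin.
Qed.

Lemma integral_weighted_snd (k : T2 -> \bar R) :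
  {ae m2, forall y, \int[m1]_x (w (x, y))%:E = 1} ->
  measurable_fun setT k -> (forall x, 0 <= k x) ->
  \int[m1 \x m2]_p ((w p)%:E * k p.2) = \int[m2]_x k x.
Proof.
move=> w1 mk k0.
have mwk : measurable_fun setT (fun p => (w p)%:E * k p.2) by mfun.
have wk0 p : 0 <= (w p)%:E * k p.2 by rewrite mule_ge0// lee_fin.
rewrite fubini_tonelli2//; apply: ae_eq_integral => //.
  exact: measurable_fun_fubini_tonelli_G.
apply: filterS w1 => y wy _; rewrite /fubini_G/= ge0_integralZr//.
- by rewrite wy mul1e.
- by mfun.
- by move=> x _; rewrite lee_fin.
Qed.

End product_marginals.

(** * Convolutions *)

Section convolution.
Local Open Scope ereal_scope.
Context (R : realType).
Local Notation lambda := (@lebesgue_measure R).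
Variables (m : {sigma_finite_measure set (measurableTypeR R) -> \bar R}).
Variables (e g : R -> R) (k : R -> \bar R).
Hypotheses (me : measurable_fun setT e) (e0 : forall x, (0 <= e x)%R).
Hypotheses (mg : measurable_fun setT g).
Hypotheses (mk : measurable_fun setT k) (k0 : forall x, 0 <= k x).

(** One shape serves all later uses: [g] is the identity or negation, and [m] is Lebesgue measure
    with [e] a density, or a law with [e = 1]. *)
Definition convol (c : R) := \int[m]_a ((e a)%:E * k (c + g a)%R).

Lemma convol_ge0 c : 0 <= convol c.
Proof. by apply: integral_ge0 => a _; rewrite mule_ge0// lee_fin. Qed.

Let f (p : measurableTypeR R * measurableTypeR R) := (e p.2)%:E * k (p.1 + g p.2)%R.

Let mf : measurable_fun setT f.
Proof. by rewrite /f; mfun. Qed.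

Let f0 p : 0 <= f p.
Proof. by rewrite mule_ge0// lee_fin. Qed.

Lemma measurable_convol : measurable_fun setT convol.
Proof. exact: (measurable_fun_fubini_tonelli_F (m2 := m) f mf f0). Qed.

(** After Tonelli, translation invariance makes the inner integral independent of [a]. *)
Lemma integral_convol :
  \int[lambda]_c convol c = \int[m]_a (e a)%:E * \int[lambda]_c k c.
Proof.
transitivity (\int[lambda \x m]_p f p); first by rewrite fubini_tonelli1.
rewrite fubini_tonelli2// -ge0_integralZr//; last 3 first.
- by mfun.
- by move=> a _; rewrite lee_fin.
- exact: integral_ge0.
apply: eq_integral => a _; rewrite /fubini_G /f/= ge0_integralZl ?lee_fin//.
- by rewrite lebesgue_integral_shift.
- by mfun.
Qed.

End convolution.

(** * Two copies coupled through a common difference *)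

Section coupling.
Local Open Scope ereal_scope.
Context (R : realType).
Local Notation lambda := (@lebesgue_measure R).
Local Notation RR := (measurableTypeR R).
Variables (mu nu : probability RR R) (F D : R -> R).
Hypotheses (mF : measurable_fun setT F) (F0 : forall x, (0 <= F x)%R).
Hypotheses (mD : measurable_fun setT D) (D0 : forall x, (0 <= D x)%R).
Hypothesis lawX : has_law mu id F.
Hypothesis lawD : has_law (mu \x nu) (fun p => p.1 - p.2)%R D.

(** The explicit convolution density of [x - y] under [mu \x nu]. The given density [D] is another
    version of it, equal only almost everywhere. *)
Let K := convol nu (fun=> 1%R) id (EFin \o F).

Let KE z : K z = \int[nu]_y (F (z + y))%:E.
Proof. by apply: eq_integral => y _; rewrite mul1e. Qed.

Let F0' x : 0 <= (EFin \o F) x.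
Proof. by rewrite lee_fin. Qed.

Let mK : measurable_fun setT K.
Proof. by apply: measurable_convol => //; mfun. Qed.

Let integral_K h : measurable_fun setT h -> (forall x, 0 <= h x) ->
  \int[lambda]_z (K z * h z) = \int[lambda]_z ((D z)%:E * h z).
Proof.
move=> mh h0; rewrite -lawD// fubini_tonelli2//; last by mfun.
pose f (p : RR * RR) := (F (p.1 + p.2))%:E * h p.1.
have mf : measurable_fun setT f by rewrite /f; mfun.
have f0 p : 0 <= f p by rewrite mule_ge0// lee_fin.
transitivity (\int[lambda \x nu]_p f p).
  rewrite fubini_tonelli1//; apply: eq_integral => z _.
  rewrite KE /fubini_F /f/= ge0_integralZr ?lee_fin//; first by mfun.
    by move=> ? _; rewrite lee_fin.
rewrite fubini_tonelli2//; apply: eq_integral => y _; rewrite /fubini_G/=.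
rewrite (lawX (h := fun x => h (x - y)%R))//; last by mfun.
(* Substitution [x = z + y] for fixed [y]. *)
rewrite -(lebesgue_integral_shift y)//; last 2 first.
- by mfun.
- by move=> x; rewrite mule_ge0// lee_fin.
by apply: eq_integral => x _; rewrite addrK.
Qed.

(** [K] and [D] have the same integral over every measurable set, and [D] is integrable with total
    mass [1]. *)
Let K_ae : {ae lambda, forall z, K z = (D z)%:E}.
Proof.
have iD : lambda.-integrable setT (EFin \o D).
  apply/integrableP; split; first exact/measurable_EFinP.
  under eq_integral do rewrite /= ger0_norm//.
  by rewrite (has_law_total lawD) ltry.
have /(_ _)/ae_eq_sym := @integral_ae_eq _ _ _ lambda setT measurableT K _ iD mK.
move=> H; apply: (@filterS _ _ (ae_filter_ringOfSetsType lambda) _ _ _ (H _)).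
  by move=> z; apply.
move=> A _ mA; rewrite !(integral_mkcond A).
transitivity (\int[lambda]_z ((D z)%:E * (\1_A z)%:E)).
  by apply: eq_integral => z _; rewrite epatch_indic.
rewrite -(integral_K (h := fun x => (\1_A x)%:E)).
- by apply: eq_integral => z _; rewrite epatch_indic.
- exact/measurable_EFinP/measurable_indic.
- by move=> x; rewrite lee_fin.
Qed.

(* Density with respect to [(mu \x nu) \x nu] of the law of [((x1, y1), y2)]: given
   [z = x1 - y1], the point [y2] has density [F (z + y2) G y2 / D z]. *)
Definition coupling_weight (p : (RR * RR) * RR) : R :=
  (F (p.1.1 - p.1.2 + p.2) * (D (p.1.1 - p.1.2))^-1)%R.
Local Notation w := coupling_weight.

Lemma measurable_coupling_weight : measurable_fun setT w.
Proof. by rewrite /w; mfun. Qed.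

Lemma coupling_weight_ge0 p : (0 <= w p)%R.
Proof. by rewrite mulr_ge0// invr_ge0. Qed.

Lemma coupling_weight_fst :
  {ae (mu \x nu)%E, forall v, \int[nu]_y (w (v, y))%:E = 1}.
Proof.
(* [q z] is the integral of the weight over [y2] when [x1 - y1 = z]. It is [1] where [K z = D z] and
   [D z] is nonzero, so [D] vanishes almost everywhere on the exceptional set, which the difference
   therefore avoids. *)
pose q z := K z * ((D z)^-1)%:E.
have mq : measurable_fun setT q by rewrite /q; mfun.
have mB : measurable (~` (q @^-1` [set 1])).
  by apply: measurableC; rewrite -[X in measurable X]setTI; exact: mq.
have BD : {ae lambda, forall z, (~` (q @^-1` [set 1])) z -> D z = 0%R}.
  apply: (@filterS _ _ (ae_filter_ringOfSetsType lambda) _ _ _ K_ae).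
  move=> z Kz /=; rewrite /q Kz -EFinM => qz; apply/eqP/negPn/negP => Dz.
  by apply: qz; rewrite divff.
have mZ : measurable_fun setT (fun p : RR * RR => p.1 - p.2)%R by mfun.
apply: filterS (has_law_ae mZ mD lawD mB BD) => -[x y] /= /contrapT qxy.
under eq_integral do rewrite /w/= EFinM.
rewrite ge0_integralZr//=.
- by rewrite -KE.
- by mfun.
- by move=> z _; rewrite lee_fin.
- by rewrite lee_fin invr_ge0.
Qed.

(** Under the law [D] of [z], the weight integrates to the integral of [F (z + y)] over the [z] with
    [D z] nonzero. The part missing from [1] is the integral over the zero set of [D]; it vanishes
    for almost every [y], since its [nu]-average is the integral of [K], hence of [D], over that
    set. *)
Lemma coupling_weight_snd :
  {ae nu, forall y, \int[mu \x nu]_v (w (v, y))%:E = 1}.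
Proof.
pose j z : R := \1_(D @^-1` [set 0%R]) z.
have mj : measurable_fun setT j.
  by apply: measurable_indic; rewrite -[X in measurable X]setTI; exact: mD.
have j0 z : (0 <= j z)%R by rewrite /j.
pose f (p : RR * RR) := (F (p.1 + p.2))%:E * (j p.1)%:E.
have mf : measurable_fun setT f by rewrite /f; mfun.
have f0 p : 0 <= f p by rewrite mule_ge0// lee_fin.
have intf0 : \int[nu]_y \int[lambda]_z f (z, y) = 0.
  transitivity (\int[lambda]_z (K z * (j z)%:E)).
    transitivity (\int[lambda \x nu]_p f p); first by rewrite fubini_tonelli2.
    rewrite fubini_tonelli1//; apply: eq_integral => z _.
    rewrite KE /fubini_F /f/= ge0_integralZr ?lee_fin//; first by mfun.
    by move=> ? _; rewrite lee_fin.
  rewrite integral_K//; last by mfun.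
  apply: integral0_eq => z _; rewrite -EFinM /j indicE.
  have [|] := boolP (z \in _); last by rewrite mulr0.
  by rewrite inE /= => ->; rewrite mul0r.
have mintf : measurable_fun setT (fun y => \int[lambda]_z f (z, y)).
  exact: (measurable_fun_fubini_tonelli_G (m1 := lambda) f mf f0).
have : ae_eq nu setT (fun y => \int[lambda]_z f (z, y)) (cst 0).
  apply/ae_eq_integral_abs => //; rewrite -[RHS]intf0.
  by apply: eq_integral => y _; rewrite gee0_abs// integral_ge0.
apply: filterS => y /(_ I) fy.
rewrite (lawD (h := fun z => (F (z + y) * (D z)^-1)%:E)); last 2 first.
- by mfun.
- by move=> z; rewrite lee_fin mulr_ge0// invr_ge0.
(* Adding the null contribution of the zero set of [D] restores the full integral of [F (z + y)]. *)
rewrite -[LHS]adde0 -[X in _ + X]fy -ge0_integralD//; last 3 first.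
- by move=> z _; rewrite -EFinM lee_fin !mulr_ge0// invr_ge0.
- by mfun.
- by rewrite /f; mfun.
rewrite -(has_law_total lawX) -(lebesgue_integral_shift y (h := EFin \o F))//;
  last exact/measurable_EFinP.
apply: eq_integral => z _; rewrite /f /j indicE /= -!EFinM -EFinD.
have [|] := boolP (z \in _); rewrite ?inE ?notin_setE/=.
  by move=> ->; rewrite mul0r add0r mulr1.
by move=> /eqP Dz; rewrite mulr0 addr0 mulrCA divff// mulr1.
Qed.

Lemma coupling_weight_total : \int[(mu \x nu) \x nu]_p (w p)%:E = 1.
Proof.
rewrite -(integral_cst_prob (mu \x nu)%E 1).
rewrite -(integral_weighted_fst measurable_coupling_weight coupling_weight_ge0
  coupling_weight_fst (k := cst 1))//.
by apply: eq_integral => p _; rewrite mule1.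
Qed.

Definition coupling : probability ((RR * RR) * RR)%type R :=
  density_prob measurable_coupling_weight coupling_weight_ge0 coupling_weight_total.

Lemma integral_coupling h : measurable_fun setT h -> (forall p, 0 <= h p) ->
  \int[coupling]_p h p = \int[(mu \x nu) \x nu]_p ((w p)%:E * h p).
Proof.
move=> mh h0; apply: integral_density => //.
- exact: measurable_coupling_weight.
- exact: coupling_weight_ge0.
Qed.

Lemma integral_coupling_fst h : measurable_fun setT h -> (forall p, 0 <= h p) ->
  \int[coupling]_p h p.1 = \int[mu \x nu]_v h v.
Proof.
move=> mh h0; rewrite (integral_coupling (h := fun p => h p.1))//; last by mfun.
apply: integral_weighted_fst => //.
- exact: measurable_coupling_weight.
- exact: coupling_weight_ge0.
- exact: coupling_weight_fst.
Qed.

Lemma integral_coupling_snd h : measurable_fun setT h -> (forall p, 0 <= h p) ->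
  \int[coupling]_p h p.2 = \int[nu]_y h y.
Proof.
move=> mh h0; rewrite (integral_coupling (h := fun p => h p.2))//; last by mfun.
apply: integral_weighted_snd => //.
- exact: measurable_coupling_weight.
- exact: coupling_weight_ge0.
- exact: coupling_weight_snd.
Qed.

(* A point [p] of the product stands for [(((x1, y1), y2), (x3, y3))]; the
   coordinate [x2 = x1 - y1 + y2] is redundant. *)
Local Notation M := (coupling \x (mu \x nu)
  : probability (((RR * RR) * RR) * (RR * RR))%type R).

Lemma law_x1 : has_law M (fun p => p.1.1.1) F.
Proof.
move=> h mh h0.
rewrite (integral_prod_fst coupling (mu \x nu) (k := fun q => h q.1.1))//; last by mfun.
rewrite (integral_coupling_fst (h := fun v => h v.1))//; last by mfun.
by rewrite integral_prod_fst// lawX.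
Qed.

Lemma law_x1y1 : has_law M (fun p => p.1.1.1 - p.1.1.2)%R D.
Proof.
move=> h mh h0.
rewrite (integral_prod_fst coupling (mu \x nu) (k := fun q => h (q.1.1 - q.1.2)%R))//; last by mfun.
rewrite (integral_coupling_fst (h := fun v => h (v.1 - v.2)%R))//; last by mfun.
by rewrite lawD.
Qed.

Lemma law_y2 G : has_law nu id G -> has_law M (fun p => p.1.2) G.
Proof.
move=> lawY h mh h0.
rewrite (integral_prod_fst coupling (mu \x nu) (k := fun q => h q.2))//; last by mfun.
by rewrite integral_coupling_snd// lawY.
Qed.

Lemma law_x3y3 S : has_law (mu \x nu) (fun p => p.1 + p.2)%R S ->
  has_law M (fun p => p.2.1 + p.2.2)%R S.
Proof.
move=> lawS h mh h0.
rewrite (integral_prod_snd coupling (mu \x nu) (k := fun q => h (q.1 + q.2)%R))//; last by mfun.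
by rewrite lawS.
Qed.

(** [x1] belongs to the coupled triple and [y3] to the independent copy; they are independent with
    laws [mu] and [nu], because the first marginal of the coupling is [mu \x nu]. *)
Lemma law_x1y3 : has_law M (fun p => p.1.1.1 - p.2.2)%R D.
Proof.
move=> h mh h0; rewrite -lawD//.
rewrite fubini_tonelli2//; last by mfun.
rewrite [RHS]fubini_tonelli2//; last by mfun.
(* Both sides become integrals over [(x3, y3)]. *)
rewrite -[RHS](integral_prod_snd mu nu); last 2 first.
- by apply: measurable_fun_fubini_tonelli_G => //; mfun.
- by move=> y; exact: integral_ge0.
apply: eq_integral => u _; rewrite /fubini_G/=.
rewrite (integral_coupling_fst (h := fun v => h (v.1 - u.2)%R))//; last by mfun.
by rewrite (integral_prod_fst mu nu (k := fun x => h (x - u.2)%R))//; mfun.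
Qed.

(** Here the second marginal of the coupling enters: [y2] has law [nu] and is independent of
    [x3]. *)
Lemma law_x3y2 : has_law M (fun p => p.2.1 - p.1.2)%R D.
Proof.
move=> h mh h0; rewrite -lawD//.
rewrite fubini_tonelli2//; last by mfun.
rewrite [RHS]fubini_tonelli1//; last by mfun.
rewrite -[RHS](integral_prod_fst mu nu); last 2 first.
- by apply: measurable_fun_fubini_tonelli_F => //; mfun.
- by move=> y; exact: integral_ge0.
apply: eq_integral => u _; rewrite /fubini_G/fubini_F/=.
by rewrite (integral_coupling_snd (h := fun y => h (u.1 - y)%R))//; mfun.
Qed.

End coupling.

(** * The expectation of the ratio is at most one *)

Lemma lebesgue_integral_reflect (R : realType) (c : R) (h : R -> \bar R) :
  measurable_fun setT h -> (forall x, 0 <= h x)%E ->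
  (\int[@lebesgue_measure R]_x h (c - x)%R = \int[@lebesgue_measure R]_x h x)%E.
Proof.
move=> mh h0; rewrite -[RHS](lebesgue_integral_shift c)//.
rewrite -[RHS]lebesgue_integral_opp//; last by mfun.
by apply: eq_integral => x _; rewrite addrC.
Qed.

(** Inverses enter as independent variables; [e * g] is to be [(D z)^-1 * D z]. *)
Lemma weight_ratio_rearrange (R : comRingType) (a b c d d' e f g : R) :
  f * e * (a * (b * d * (c * d' * g))) = a * (b * d) * (c * (d' * f)) * (e * g).
Proof. by ring. Qed.

Section entropy_ratio.
Local Open Scope ereal_scope.
Context (R : realType).
Local Notation lambda := (@lebesgue_measure R).
Local Notation RR := (measurableTypeR R).
Variables (mu nu : probability RR R) (F G S D : R -> R).
Hypotheses (mF : measurable_fun setT F) (F0 : forall x, (0 <= F x)%R).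
Hypotheses (mG : measurable_fun setT G) (G0 : forall x, (0 <= G x)%R).
Hypotheses (mS : measurable_fun setT S) (S0 : forall x, (0 <= S x)%R).
Hypotheses (mD : measurable_fun setT D) (D0 : forall x, (0 <= D x)%R).
Hypotheses (lawX : has_law mu id F) (lawY : has_law nu id G).
Hypothesis lawS : has_law (mu \x nu) (fun p => p.1 + p.2)%R S.
Hypothesis lawD : has_law (mu \x nu) (fun p => p.1 - p.2)%R D.

(** [Phi], [Psi] and [Theta] are the densities of [a + x2], [a + x2 + y1] and [a - b + x2 + y1], for
    independent [a], [b] of density [D], [x2] of density [F] and [y1] of law [nu]. *)
Let Phi := convol lambda D -%R (EFin \o F).
Let Psi := convol nu (fun=> 1%R) -%R Phi.
Let Theta := convol lambda D id Psi.

Let F0' x : 0 <= (EFin \o F) x. Proof. by rewrite lee_fin. Qed.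
Let mF' : measurable_fun setT (EFin \o F). Proof. by mfun. Qed.
Let Phi0 x : 0 <= Phi x. Proof. exact: convol_ge0. Qed.
Let mPhi : measurable_fun setT Phi. Proof. by apply: measurable_convol => //; mfun. Qed.
Let Psi0 x : 0 <= Psi x. Proof. exact: convol_ge0. Qed.
Let mPsi : measurable_fun setT Psi. Proof. by apply: measurable_convol => //; mfun. Qed.
Let Theta0 x : 0 <= Theta x. Proof. exact: convol_ge0. Qed.
Let mTheta : measurable_fun setT Theta. Proof. by apply: measurable_convol => //; mfun. Qed.

Let integral_Theta : \int[lambda]_x Theta x = 1.
Proof.
rewrite integral_convol// (has_law_total lawD) mul1e integral_convol//.
rewrite integral_cst_prob mul1e integral_convol//.
by rewrite (has_law_total lawD) mul1e (has_law_total lawX).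
Qed.

(** The factors of [r] are grouped by order of integration: those with [y2] innermost, then those
    with [x1], and [S (x3 + y3)] last. *)
Definition entropy_ratio (p : ((RR * RR) * RR) * (RR * RR)) : R :=
  ((S (p.2.1 + p.2.2))^-1 * ((F p.1.1.1)^-1 * D (p.1.1.1 - p.2.2) *
   ((G p.1.2)^-1 * D (p.2.1 - p.1.2) * D (p.1.1.1 - p.1.1.2))))%R.

Lemma measurable_entropy_ratio : measurable_fun setT entropy_ratio.
Proof. by rewrite /entropy_ratio; mfun. Qed.

Lemma entropy_ratio_ge0 p : (0 <= entropy_ratio p)%R.
Proof. by rewrite /entropy_ratio !mulr_ge0 ?invr_ge0. Qed.

Let coeff (u : RR * RR) (x : R) : R :=
  ((S (u.1 + u.2))^-1 * ((F x)^-1 * D (x - u.2)))%R.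

Let coeff0 u x : (0 <= coeff u x)%R.
Proof. by rewrite !mulr_ge0 ?invr_ge0. Qed.

Let mcoeff u : measurable_fun setT (coeff u).
Proof. by rewrite /coeff; mfun. Qed.

Let bnd (u : RR * RR) (q : (RR * RR) * RR) : R :=
  (coeff u q.1.1 * ((G q.2)^-1 * (D (u.1 - q.2) * F (q.1.1 - q.1.2 + q.2))))%R.

Let mbnd u : measurable_fun setT (EFin \o bnd u).
Proof. by rewrite /bnd; mfun. Qed.

Let bnd0 u q : 0 <= (EFin \o bnd u) q.
Proof. by rewrite lee_fin !mulr_ge0 ?invr_ge0. Qed.

(** [bnd] is the product of weight and ratio after cancelling [D z]. Equality holds when [D z] is
    nonzero; otherwise the left side is [0]. *)
Let weight_ratio_le u q : (coupling_weight F D q * entropy_ratio (q, u) <= bnd u q)%R.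
Proof.
rewrite /coupling_weight /entropy_ratio /bnd /coeff/=; set z := (q.1.1 - q.1.2)%R.
have [Dz|Dz] := eqVneq (D z) 0%R.
  rewrite Dz !mulr0; exact: (bnd0 u q).
rewrite le_eqVlt; apply/orP; left; apply/eqP; rewrite -[RHS]mulr1 -(mulVf Dz).
exact: weight_ratio_rearrange.
Qed.

Let bnd_step1 u v : \int[nu]_y (bnd u (v, y))%:E <=
  (coeff u v.1)%:E * Phi (v.1 - v.2 + u.1)%R.
Proof.
under eq_integral do rewrite /bnd/= EFinM.
rewrite ge0_integralZl ?lee_fin//; last 2 first.
- by mfun.
- by move=> y _; rewrite lee_fin !mulr_ge0 ?invr_ge0.
rewrite lee_wpmul2l ?lee_fin//; under eq_integral do rewrite EFinM.
(* Substitution [a = x3 - y2]; the factor [G y2] then cancels against the density of [nu]. *)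
have -> : Phi (v.1 - v.2 + u.1)%R =
    \int[lambda]_y (D (u.1 - y) * F (v.1 - v.2 + y))%:E.
  rewrite -[RHS](lebesgue_integral_reflect u.1); last 2 first.
  - by mfun.
  - by move=> y; rewrite lee_fin mulr_ge0.
  by apply: eq_integral => a _; rewrite subKr EFinM /= addrA.
apply: (has_law_invr_le mG G0 lawY (h := fun y => (D (u.1 - y) * F (v.1 - v.2 + y))%:E)).
- by mfun.
- by move=> y; rewrite lee_fin mulr_ge0.
Qed.

Let bnd_step2 u : \int[(mu \x nu) \x nu]_q (bnd u q)%:E <=
  ((S (u.1 + u.2))^-1)%:E * Theta (u.1 + u.2)%R.
Proof.
pose m2 : probability (RR * RR)%type R := mu \x nu.
rewrite [leLHS](fubini_tonelli1 (m1 := m2) (m2 := nu) (EFin \o bnd u) (mbnd u) (bnd0 u)).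
pose b (v : RR * RR) := (coeff u v.1)%:E * Phi (v.1 - v.2 + u.1)%R.
have mb : measurable_fun setT b.
  rewrite /b; apply: emeasurable_funM; last by mfun.
  by apply/measurable_EFinP; apply: (measurableT_comp (mcoeff u)); mfun.
have b0 v : 0 <= b v by rewrite mule_ge0// lee_fin.
apply: (@le_trans _ _ (\int[mu \x nu]_v b v)).
  apply: ge0_le_integral => //.
  - by move=> v _; exact: integral_ge0.
  - exact: measurable_fun_fubini_tonelli_F.
  - by move=> v _; exact: bnd_step1.
rewrite fubini_tonelli1//.
pose k (x : RR) := (D (x - u.2))%:E * Psi (x + u.1)%R.
have mk : measurable_fun setT k.
  apply: emeasurable_funM; first by mfun.
  by apply: (measurableT_comp mPsi); mfun.
have k0 x : 0 <= k x by rewrite mule_ge0// lee_fin.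
rewrite (eq_integral (fun x : RR => ((S (u.1 + u.2))^-1)%:E * (((F x)^-1)%:E * k x))).
  rewrite ge0_integralZl//; last 3 first.
  - by mfun.
  - by move=> x _; rewrite mule_ge0// lee_fin invr_ge0.
  - by rewrite lee_fin invr_ge0.
  rewrite lee_wpmul2l ?lee_fin ?invr_ge0//.
  apply: le_trans (has_law_invr_le mF F0 lawX mk k0) _.
  (* With [F x1] cancelled, the substitution [b = x1 - y3] turns the integral over [x1] into
     [Theta (x3 + y3)]. *)
  rewrite -(lebesgue_integral_shift u.2 mk k0) le_eqVlt; apply/orP; left; apply/eqP.
  apply: eq_integral => x _; rewrite /k addrK; congr (_ * Psi _).
  by rewrite -addrA addrC (addrC u.2).
move=> x _; rewrite /fubini_F /b/= ge0_integralZl ?lee_fin//; last by mfun.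
rewrite /coeff !EFinM /k -!muleA; congr (_ * (_ * (_ * _))).
by apply: eq_integral => y _; rewrite mul1e addrAC.
Qed.

Lemma integral_ratio_le1 :
  \int[coupling mF F0 mD D0 lawX lawD \x (mu \x nu)]_p (entropy_ratio p)%:E <= 1.
Proof.
have mr : measurable_fun setT (EFin \o entropy_ratio).
  by apply/measurable_EFinP; exact: measurable_entropy_ratio.
have r0 p : 0 <= (EFin \o entropy_ratio) p by rewrite lee_fin entropy_ratio_ge0.
pose m2 : probability (RR * RR)%type R := mu \x nu.
rewrite [leLHS](fubini_tonelli2 (m1 := coupling mF F0 mD D0 lawX lawD)
  (m2 := m2) (EFin \o entropy_ratio) mr r0).
(* The bound [1] is read as the mass of [Theta], which dominates the expectation of [Theta / S] at
   [x3 + y3]. *)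
rewrite -integral_Theta.
have mZ : measurable_fun setT (fun p : RR * RR => p.1 + p.2)%R by mfun.
apply: le_trans (has_law_invr_le mS S0 lawS mTheta Theta0).
apply: ge0_le_integral => //.
- by move=> u _; exact: integral_ge0.
- exact: measurable_fun_fubini_tonelli_G.
- apply: emeasurable_funM; first by mfun.
  exact: (measurableT_comp mTheta mZ).
move=> u _; rewrite /fubini_G.
rewrite (integral_coupling _ _ _ _ _ _ (h := fun q => (entropy_ratio (q, u))%:E)); last 2 first.
- by rewrite /entropy_ratio; mfun.
- by move=> q; rewrite lee_fin entropy_ratio_ge0.
apply: le_trans (bnd_step2 u); apply: ge0_le_integral => //.
- by move=> q _; rewrite mule_ge0 ?lee_fin ?entropy_ratio_ge0 ?coupling_weight_ge0.
- by rewrite /coupling_weight /entropy_ratio; mfun.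
- exact: mbnd.
- by move=> q _; rewrite -EFinM lee_fin.
Qed.

End entropy_ratio.

Lemma ratio_rearrange (R : comRingType) (d1 d2 d3 f g s : R) :
  d1 * d2 * d3 * f * g * s = s * (f * d2 * (g * d1 * d3)).
Proof. by ring. Qed.

Lemma entropy_rearrange (R : realFieldType) (hD hF hG hS : R) :
  - hD + - hD + - hD - - hF - - hG - - hS <= 0 -> hS <= 3 * hD - hF - hG.
Proof. by move=> ?; lra. Qed.

(** * From the expected logarithm of the ratio to entropies *)

Section entropy_inequality.
Local Open Scope ereal_scope.
Context (R : realType).
Local Notation RR := (measurableTypeR R).
Variables (mu nu : probability RR R) (F G S D : R -> R).
Hypotheses (mF : measurable_fun setT F) (F0 : forall x, (0 <= F x)%R).
Hypotheses (mG : measurable_fun setT G) (G0 : forall x, (0 <= G x)%R).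
Hypotheses (mS : measurable_fun setT S) (S0 : forall x, (0 <= S x)%R).
Hypotheses (mD : measurable_fun setT D) (D0 : forall x, (0 <= D x)%R).
Hypotheses (lawX : has_law mu id F) (lawY : has_law nu id G).
Hypothesis lawS : has_law (mu \x nu) (fun p => p.1 + p.2)%R S.
Hypothesis lawD : has_law (mu \x nu) (fun p => p.1 - p.2)%R D.

Let M : probability (((RR * RR) * RR) * (RR * RR))%type R :=
  coupling mF F0 mD D0 lawX lawD \x (mu \x nu).

Let phi (p : ((RR * RR) * RR) * (RR * RR)) : R :=
  (ln (D (p.2.1 - p.1.2)) + ln (D (p.1.1.1 - p.2.2)) + ln (D (p.1.1.1 - p.1.1.2))
   - ln (F p.1.1.1) - ln (G p.1.2) - ln (S (p.2.1 + p.2.2)))%R.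

(** Each density is almost surely positive at its own variable, so the exponential undoes each
    logarithm in [phi]. *)
Let expR_phi_ae : {ae M, forall p, expR (phi p) = entropy_ratio F G S D p}.
Proof.
have d1 := has_law_gt0 _ mD D0 (law_x3y2 mF F0 mD D0 lawX lawD).
have d2 := has_law_gt0 _ mD D0 (law_x1y3 mF F0 mD D0 lawX lawD).
have d3 := has_law_gt0 _ mD D0 (law_x1y1 mF F0 mD D0 lawX lawD).
have f1 := has_law_gt0 _ mF F0 (law_x1 mF F0 mD D0 lawX lawD).
have g1 := has_law_gt0 _ mG G0 (law_y2 mF F0 mD D0 lawX lawD lawY).
have s1 := has_law_gt0 _ mS S0 (law_x3y3 mF F0 mD D0 lawX lawD lawS).
apply: filterS (filterI (d1 _) (filterI (d2 _) (filterI (d3 _)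
  (filterI (f1 _) (filterI (g1 _) (s1 _)))))); try by mfun.
move=> p [pd1 [pd2 [pd3 [pf1 [pg1 ps1]]]]].
by rewrite /phi !(expRD, expRN) !lnK ?posrE// ratio_rearrange.
Qed.

Lemma entropy_sum_difference :
  finite_entropy F -> finite_entropy G -> finite_entropy S -> finite_entropy D ->
  (diff_entropy S <= 3 * diff_entropy D - diff_entropy F - diff_entropy G)%R.
Proof.
move=> eF eG eS eD.
have [|i1 I1] := has_law_integral_ln _ mD D0 (law_x3y2 mF F0 mD D0 lawX lawD) eD.
  by mfun.
have [|i2 I2] := has_law_integral_ln _ mD D0 (law_x1y3 mF F0 mD D0 lawX lawD) eD.
  by mfun.
have [|i3 I3] := has_law_integral_ln _ mD D0 (law_x1y1 mF F0 mD D0 lawX lawD) eD.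
  by mfun.
have [|i4 I4] := has_law_integral_ln _ mF F0 (law_x1 mF F0 mD D0 lawX lawD) eF.
  by mfun.
have [|i5 I5] := has_law_integral_ln _ mG G0 (law_y2 mF F0 mD D0 lawX lawD lawY) eG.
  by mfun.
have [|i6 I6] := has_law_integral_ln _ mS S0 (law_x3y3 mF F0 mD D0 lawX lawD lawS) eS.
  by mfun.
(* Integrability is built up in the order in which [phi] is parenthesized, so that its integral
   splits by linearity below. *)
have i12 := integrableD measurableT i1 i2.
have i123 := integrableD measurableT i12 i3.
have i1234 := integrableB measurableT i123 i4.
have i12345 := integrableB measurableT i1234 i5.
have iphi := integrableB measurableT i12345 i6.
have mphi : measurable_fun setT phi by rewrite /phi; mfun.
have : (Rintegral M setT phi <= 0)%R.
  apply: Rintegral_le0_expR; first exact: iphi.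
  apply: le_trans (integral_ratio_le1 mF F0 mG G0 mS S0 mD D0 lawX lawY lawS lawD).
  rewrite le_eqVlt; apply/orP; left; apply/eqP; apply: ae_eq_integral => //.
  - by mfun.
  - by apply/measurable_EFinP; exact: measurable_entropy_ratio.
  - by apply: filterS expR_phi_ae => p -> _.
rewrite (RintegralB measurableT i12345 i6) (RintegralB measurableT i1234 i5).
rewrite (RintegralB measurableT i123 i4) (RintegralD measurableT i12 i3).
rewrite (RintegralD measurableT i1 i2) I1 I2 I3 I4 I5 I6.
exact: entropy_rearrange.
Qed.

End entropy_inequality.

(** * Passage from random variables to product laws *)

Section independence.
Local Open Scope ereal_scope.
Context d (T : measurableType d) (R : realType) (P : probability T R).
Variables X Y : {mfun T >-> measurableTypeR R}.

Lemma integral_indep2 (k : measurableTypeR R * measurableTypeR R -> \bar R) :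
  indep2 P X Y -> measurable_fun setT k -> (forall p, 0 <= k p) ->
  \int[distribution P X \x distribution P Y]_p k p = \int[P]_t k (X t, Y t).
Proof.
move=> XY mk k0.
have mXY : measurable_fun setT (fun t => (X t, Y t)).
  by apply/measurable_fun_pair.
transitivity (\int[pushforward P (fun t => (X t, Y t))]_p k p).
  apply: eq_measure_integral => A mA _.
  (* Independence says that the joint law agrees with the product of the marginal laws on
     rectangles, which determines it. *)
  exact: product_measure_unique.
by rewrite ge0_integral_pushforward.
Qed.

Lemma has_law_distribution f : is_density P X f -> has_law (distribution P X) id f.
Proof.
move=> Xf h mh h0; rewrite ge0_integral_pushforward//.
exact: (is_density_has_law (measurable_funPT X) Xf).
Qed.

End independence.

Theorem mainTheorem7 (R : realType) (d : measure_display) (T : measurableType d)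
  (P : probability T R) (X Y : T -> R) (fX fY fS fD : R -> R) :
  measurable_fun setT X -> measurable_fun setT Y ->
  indep2 P X Y ->
  is_density P X fX -> is_density P Y fY ->
  is_density P (X \+ Y) fS -> is_density P (X \- Y) fD ->
  finite_entropy fX -> finite_entropy fY ->
  finite_entropy fS -> finite_entropy fD ->
  diff_entropy fS <= 3 * diff_entropy fD - diff_entropy fX - diff_entropy fY.
Proof.
move=> mX mY XY dX dY dS dD eX eY eS eD.
pose X' : {mfun T >-> measurableTypeR R} :=
  HB.pack (X : T -> measurableTypeR R)
    (isMeasurableFun.Build _ _ T (measurableTypeR R) X mX).
pose Y' : {mfun T >-> measurableTypeR R} :=
  HB.pack (Y : T -> measurableTypeR R)
    (isMeasurableFun.Build _ _ T (measurableTypeR R) Y mY).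
have lawX : has_law (distribution P X') id fX by exact: has_law_distribution.
have lawY : has_law (distribution P Y') id fY by exact: has_law_distribution.
(* By independence, the densities of the sum and the difference on [T] are also those of [p.1 + p.2]
   and [p.1 - p.2] under the product of the two laws. *)
have lawS : has_law (distribution P X' \x distribution P Y')%E (fun p => p.1 + p.2) fS.
  move=> h mh h0; rewrite (integral_indep2 (k := fun p => h (p.1 + p.2)))//; last by mfun.
  by rewrite -(is_density_has_law _ dS)//; exact: measurable_funD.
have lawD : has_law (distribution P X' \x distribution P Y')%E (fun p => p.1 - p.2) fD.
  move=> h mh h0; rewrite (integral_indep2 (k := fun p => h (p.1 - p.2)))//; last by mfun.
  by rewrite -(is_density_has_law _ dD)//; exact: measurable_funB.
case: dX dY dS dD => [mF F0 _] [mG G0 _] [mS S0 _] [mD D0 _].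
exact: (entropy_sum_difference mF F0 mG G0 mS S0 mD D0 lawX lawY lawS lawD).
Qed.
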